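(* Let $\mathbb{K}$ be a field, let $h\ge 1$ and $n\ge 2$ be integers, and let $\mathbf{a},\mathbf{d}\in\mathbb{N}^2$ be linearly independent over $\mathbb{Q}$ such that $\Gamma^{2}_{\mathbf{a},\mathbf{d},h}=\langle\mathbf{a},h\mathbf{a}+\mathbf{d},h\mathbf{a}+2\mathbf{d},\dots,h\mathbf{a}+n\mathbf{d}\rangle$ is minimally generated by the listed vectors. Let $I_{\Gamma^{2}_{\mathbf{a},\mathbf{d},h}}\subset\mathbb{K}[x_1,\dots,x_{n+1}]$ be the defining ideal of $\mathbb{K}[\Gamma^{2}_{\mathbf{a},\mathbf{d},h}]$, and let $$P=\begin{pmatrix}x_1^h&x_2&\cdots&x_n\\ x_2&x_3&\cdots&x_{n+1}\end{pmatrix}.$$ Then $I_{\Gamma^{2}_{\mathbf{a},\mathbf{d},h}}=I_2(P)$, and a minimal graded resolution of $I_{\Gamma^{2}_{\mathbf{a},\mathbf{d},h}}$ is given by the Eagon-Northcott complex of $P$.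
   Context: $\langle\cdot\rangle$ denotes the subsemigroup of $\mathbb{N}^2$ (containing $0$) generated by the listed vectors. For a semigroup $\Gamma\subset\mathbb{N}^2$, $\mathbb{K}[\Gamma]$ is the subalgebra of $\mathbb{K}[t_1,t_2]$ spanned by the monomials $\mathbf{t}^\gamma=t_1^{\gamma_1}t_2^{\gamma_2}$, $\gamma\in\Gamma$. The defining ideal is the kernel of $\phi:\mathbb{K}[x_1,\dots,x_{n+1}]\to\mathbb{K}[\Gamma^2_{\mathbf{a},\mathbf{d},h}]$, $\phi(x_1)=\mathbf{t}^{\mathbf{a}}$, $\phi(x_{i+1})=\mathbf{t}^{h\mathbf{a}+i\mathbf{d}}$ for $1\le i\le n$; the polynomial ring is $\mathbb{N}^2$-graded by $\deg x_1=\mathbf{a}$, $\deg x_{i+1}=h\mathbf{a}+i\mathbf{d}$. $I_2(P)$ is the ideal generated by the $2\times 2$ minors of $P$. Put $R=\mathbb{K}[x_1,\dots,x_{n+1}]$, $F=R^n$, $G=R^2$, and let $\alpha:F\to G$ be the map with matrix $P$. The Eagon-Northcott complex of $P$ is $$0\to(\mathrm{Sym}_{n-2}G)^*\otimes\wedge^nF\to\cdots\to(\mathrm{Sym}_2G)^*\otimes\wedge^4F\to G^*\otimes\wedge^3F\to\wedge^2F\xrightarrow{\wedge^2\alpha}\wedge^2G$$ with the standard differentials; as usual it is a resolution of the cyclic module $R/I_2(P)$, equivalently of the ideal after dropping the last term. *)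

(* Defs.v *)
(* Elements of N^2 are represented by the type 'X_{1..2}, so that the monomial
   t^gamma is 'X_[gamma] : {mpoly K[2]}. Indices start at 0: the
   variable x_(i+1) is 'X_i. *)
From mathcomp Require Import all_boot all_order all_algebra.
From mathcomp Require Export mpoly.

Set Implicit Arguments.
Unset Strict Implicit.
Unset Printing Implicit Defensive.

Import GRing.Theory.
Local Open Scope ring_scope.

(* The degree of the monomial x^u when x_i has degree w i. *)
Definition wdeg m (w : 'I_m -> 'X_{1..2}) (u : 'X_{1..m}) : 'X_{1..2} :=
  (\sum_(i < m) w i *+ u i)%MM.

Section Semigroup.

Variables (m : nat) (g : 'I_m -> 'X_{1..2}).

Definition semigroup (J : {set 'I_m}) (gamma : 'X_{1..2}) : Prop :=
  exists c : 'I_m -> nat, gamma = (\sum_(i in J) g i *+ c i)%MM.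

Definition minimally_generating : Prop :=
  forall J : {set 'I_m}, J \proper [set: 'I_m] ->
    ~ (forall gamma, semigroup [set: 'I_m] gamma <-> semigroup J gamma).

End Semigroup.

Definition vecQ (v : 'X_{1..2}) : 'rV[rat]_2 := \row_j (v j)%:R.

Definition semigroup_algebra (K : fieldType) (Gamma : 'X_{1..2} -> Prop)
    (q : {mpoly K[2]}) : Prop :=
  forall gamma, gamma \in msupp q -> Gamma gamma.

Definition phi (K : fieldType) m (g : 'I_m -> 'X_{1..2}) (p : {mpoly K[m]}) :
    {mpoly K[2]} :=
  p \mPo [tuple 'X_[g i] | i < m].

Lemma phi_monomial (K : fieldType) m (g : 'I_m -> 'X_{1..2}) (u : 'X_{1..m}) :
  phi g 'X_[K, u] = 'X_[wdeg g u].
Proof.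
rewrite /phi comp_mpolyX /wdeg (big_morph _ (@mpolyXD 2 K) (@mpolyX0 2 K)).
by apply: eq_bigr => i _; rewrite tnth_mktuple -mpolyXn.
Qed.

Lemma phi_semigroup_algebra (K : fieldType) m (g : 'I_m -> 'X_{1..2})
    (p : {mpoly K[m]}) :
  semigroup_algebra (semigroup g [set: 'I_m]) (phi g p).
Proof.
move=> gamma; rewrite {1}(mpolyE p) /phi raddf_sum /=.
move/msupp_sum_le/flattenP => [s /mapP [u _ ->]].
rewrite comp_mpolyZ => /msuppZ_le; rewrite -/(phi g _) phi_monomial msuppX.
rewrite inE => /eqP ->; exists u; rewrite /wdeg.
by apply: eq_bigl => i; rewrite inE.
Qed.

Definition defining_ideal (K : fieldType) m (g : 'I_m -> 'X_{1..2})
    (p : {mpoly K[m]}) : Prop :=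
  phi g p = 0.
Arguments defining_ideal K {m} g p.

Definition ideal_gen (R : comNzRingType) (S : R -> Prop) (p : R) : Prop :=
  exists (l : nat) (c s : 'I_l -> R),
    (forall i, S (s i)) /\ p = \sum_i c i * s i.

Definition minor2 (R : comNzRingType) n (P : 'M[R]_(2, n)) (j1 j2 : 'I_n) : R :=
  \det (row_mx (col j1 P) (col j2 P) : 'M[R]_2).

Definition ideal_minors2 (R : comNzRingType) n (P : 'M[R]_(2, n)) : R -> Prop :=
  ideal_gen (fun q => exists j1 j2 : 'I_n, (j1 < j2)%N /\ q = minor2 P j1 j2).

(* Complexes of free R-modules F_k with finite bases, graded by N^2. [fc_twist]
   is the degree of the basis elements, so that F_k is the direct sum of the
   R(- fc_twist b), and [fc_diff k b b'] is the coefficient of b' in d(b), for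
   d : F_(k+1) -> F_k. *)
Record graded_free_complex (R : comNzRingType) := GradedFreeComplex {
  fc_basis : nat -> finType;
  fc_twist : forall k, fc_basis k -> 'X_{1..2};
  fc_diff : forall k, fc_basis k.+1 -> fc_basis k -> R
}.
Arguments fc_twist {R} C k b : rename.
Arguments fc_diff {R} C k b b' : rename.

Definition truncate (R : comNzRingType) (C : graded_free_complex R) :
    graded_free_complex R :=
  GradedFreeComplex (fun k => fc_twist C k.+1) (fun k => fc_diff C k.+1).

Definition free_map (R : comNzRingType) (B B' : finType) (D : B -> B' -> R)
    (v : {ffun B -> R}) : {ffun B' -> R} :=
  [ffun b' => \sum_b v b * D b b'].

Definition augmentation (R : comNzRingType) (B : finType) (eps : B -> R)
    (v : {ffun B -> R}) : R :=
  \sum_b v b * eps b.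

Section Resolution.

Variables (K : fieldType) (m : nat).

Variable w : 'I_m -> 'X_{1..2}.

Definition irrelevant_ideal : {mpoly K[m]} -> Prop :=
  ideal_gen (fun q => exists i, q = 'X_i).

(* The complex C, augmented by eps : F_0 -> I, is a minimal graded free
   resolution of the ideal I. The maps are homogeneous of degree 0, and
   minimality is the condition d(F_(k+1)) \subset (x_1, ..., x_m) F_k. *)
Record minimal_graded_resolution (I : {mpoly K[m]} -> Prop)
    (C : graded_free_complex {mpoly K[m]})
    (eps : fc_basis C 0 -> {mpoly K[m]}) : Prop := {
  augmentation_homogeneous : forall b u,
    u \in msupp (eps b) -> wdeg w u = fc_twist C 0 b;
  diff_homogeneous : forall k b b' u,
    u \in msupp (fc_diff C k b b') ->
    (wdeg w u + fc_twist C k b')%MM = fc_twist C k.+1 b;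
  augmentation_image : forall p, I p <-> exists v, p = augmentation eps v;
  augmentation_exact : forall v,
    augmentation eps v = 0 <-> exists z, v = free_map (fc_diff C 0) z;
  diff_exact : forall k v,
    free_map (fc_diff C k) v = 0 <-> exists z, v = free_map (fc_diff C k.+1) z;
  diff_minimal : forall k b b', irrelevant_ideal (fc_diff C k b b')
}.

End Resolution.

(* The Eagon-Northcott complex of alpha : F = R^n -> G = R^2 with matrix P.
   Write g_0, g_1 and e_0, ..., e_(n-1) for the standard bases. The term in
   degree 0 is wedge^2 G = R; the term in degree k.+1 is
   (Sym_k G)^* (x) wedge^(k+2) F, with basis the pairs (q, J) standing for
   (g_0^(k-q) g_1^q)^* (x) e_J, where the first factor is dual to the monomial
   basis of Sym_k G and e_J is the wedge product of the e_j, j in J, in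
   increasing order. *)
Section EagonNorthcott.

Variables (R : comNzRingType) (n : nat) (P : 'M[R]_(2, n)).

Definition wedge_basis (k : nat) : finType := {J : {set 'I_n} | #|J| == k}.

Definition EN_basis (k : nat) : finType :=
  if k is k'.+1 then ('I_k'.+1 * wedge_basis k'.+2)%type else unit.

(* wedge^2 alpha; for J = {j1 < j2} the sum has a single term. *)
Definition wedge2 (J : {set 'I_n}) : R :=
  \sum_(j1 in J) \sum_(j2 in J | (j1 < j2)%N) minor2 P j1 j2.

(* For k > 0 the differential is the composite of
     (Sym_k G)^* (x) wedge^(k+2) F
       -> (Sym_(k-1) G)^* (x) G^* (x) F (x) wedge^(k+1) F
       -> (Sym_(k-1) G)^* (x) wedge^(k+1) F.
   The first map is the tensor product of the dual of the multiplication of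
   Sym G, which sends (g_0^p g_1^q)^* to
   (g_0^(p-1) g_1^q)^* (x) g_0^* + (g_0^p g_1^(q-1))^* (x) g_1^*, and of the
   diagonal of wedge F, which sends e_J to the sum of the
   (-1)^#{i in J, i < j} e_j (x) e_(J - j); the second map is the contraction
   of G^* (x) F by alpha, which sends g_i^* (x) e_j to P i j. *)
Definition EN_coef (q : nat) (J : {set 'I_n}) (q' : nat) (J' : {set 'I_n}) : R :=
  \sum_(j in J | J' == J :\ j) \sum_(i < 2 | q == (q' + i)%N)
    (-1) ^+ #|[set i0 in J | (i0 < j)%N]| * P i j.

Definition EN_diff (k : nat) : EN_basis k.+1 -> EN_basis k -> R :=
  match k with
  | 0 => fun b _ => wedge2 (val b.2)
  | k'.+1 => fun b b' => EN_coef b.1 (val b.2) b'.1 (val b'.2)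
  end.

(* The grading when P i j is homogeneous of degree c j + r i: then e_j has
   degree c j and g_i has degree - r i, and the complex is shifted by
   r 0 + r 1, which gives wedge^2 G = R its usual grading. *)
Variables (c : 'I_n -> 'X_{1..2}) (r : 'I_2 -> 'X_{1..2}).

Definition EN_twist (k : nat) : EN_basis k -> 'X_{1..2} :=
  match k with
  | 0 => fun _ => 0%MM
  | k'.+1 => fun b =>
      ((\sum_(j in val b.2) c j) +
       (r ord0 *+ (k' - b.1).+1 + r ord_max *+ (b.1).+1))%MM
  end.

Definition eagon_northcott : graded_free_complex R :=
  GradedFreeComplex EN_twist EN_diff.

End EagonNorthcott.

Section TheMatrix.

Variables (K : fieldType) (a d : 'X_{1..2}) (h n : nat).

Definition gens (i : 'I_n.+1) : 'X_{1..2} :=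
  if i == ord0 then a else (a *+ h + d *+ i)%MM.

Definition matP : 'M[{mpoly K[n.+1]}]_(2, n) :=
  \matrix_(i, j) (if (i + j == 0)%N then 'X_ord0 ^+ h else 'X_(inord (i + j))).

(* matP i j is homogeneous of degree h a + (i + j) d. *)
Definition col_degree (j : 'I_n) : 'X_{1..2} := (a *+ h + d *+ j)%MM.

Definition row_degree (i : 'I_2) : 'X_{1..2} := (d *+ i)%MM.

End TheMatrix.

Arguments gens a d h n i : clear implicits.
Arguments col_degree a d h n j : clear implicits.

(* Main.v *)
(* The maximal minors of P generate the binomials x^u - x^u' with deg u = deg u':
   replacing x_i x_j (0 < i <= j < n, in 0-based indices) by x_(i-1) x_(j+1), or by
   x_0^h x_(j+1) when i = 1, leads to a monomial with at most one factor among
   x_1, ..., x_(n-1), and such a monomial is determined by its degree because a and d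
   are independent. This gives I = I_2(P).

   Let f and g be the rows of P. The strand (Sym_k G)^* (x) wedge^(k+2) F of the
   Eagon-Northcott complex is a piece of the Koszul complex of the pencil y f + g over
   the Laurent polynomials in y: a chain (v_q) is encoded by sum_q v_q y^q, and the
   Eagon-Northcott differential is the Koszul differential with the two extreme powers
   of y deleted. Over R[y] both y f + g and f + y g are regular sequences, since
   modulo the first entries one can eliminate variables one at a time; a chase
   between R[y], R[1/y] and R[y, 1/y] (the Cech complex of P^1) then turns the
   acyclicity of the Koszul complexes into that of the Eagon-Northcott complex. *)
Require Import Defs.
From mathcomp Require Import all_boot all_order all_algebra.
From mathcomp Require Import mpoly.
From mathcomp Require Import ring zify.

Set Implicit Arguments.
Unset Strict Implicit.
Unset Printing Implicit Defensive.

Import GRing.Theory.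
Local Open Scope ring_scope.

(** * Koszul complexes *)

Section Koszul.

Variables (A : comNzRingType) (n : nat).
Implicit Types (f g : 'I_n -> A) (v w : {set 'I_n} -> A) (J S : {set 'I_n}).

Definition sgn J (j : 'I_n) : A := (-1) ^+ #|[set i in J | (i < j)%N]|.

(* An element of the exterior algebra of A^n is a function v of J, the coefficient of
   e_J being v J; kos f is the contraction with the linear form f. *)
Definition kos f v J : A := \sum_(j | j \notin J) sgn J j * f j * v (j |: J).

Lemma sgnU1 J i j : i \notin J -> sgn (i |: J) j = (-1) ^+ (i < j)%N * sgn J j.
Proof.
move=> iJ; rewrite /sgn -exprD; congr (_ ^+ _).
have [ij|ij] := boolP (i < j)%N.
  rewrite (_ : [set _ in _ | _] = i |: [set i0 in J | (i0 < j)%N]); last first.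
    by apply/setP=> x; rewrite !inE; have [->|] := eqVneq x i; rewrite ?ij.
  by rewrite cardsU1 inE (negPf iJ).
congr #|pred_of_set _|; apply/setP=> x; rewrite !inE.
by have [->|] := eqVneq x i; rewrite ?(negPf ij) ?andbF.
Qed.

Lemma sgn0 j : sgn set0 j = 1.
Proof.
rewrite /sgn (_ : [set _ in _ | _] = set0) ?cards0 //.
by apply/setP=> x; rewrite !inE.
Qed.

Lemma sgn_sqr J j : sgn J j * sgn J j = 1.
Proof. by rewrite /sgn -expr2 sqrr_sign. Qed.

Lemma eq_kos f g v w J : f =1 g -> (forall j, j \notin J -> v (j |: J) = w (j |: J)) ->
  kos f v J = kos g w J.
Proof. by move=> fg vw; apply: eq_bigr => j jJ; rewrite fg vw. Qed.

Lemma kosD f v w J : kos f (fun J => v J + w J) J = kos f v J + kos f w J.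
Proof. by rewrite /kos -big_split; apply: eq_bigr => j _; rewrite /= mulrDr. Qed.

Lemma kosZ f c v J : kos f (fun J => c * v J) J = c * kos f v J.
Proof. by rewrite /kos mulr_sumr; apply: eq_bigr => j _; ring. Qed.

Lemma kosN f v J : kos f (fun J => - v J) J = - kos f v J.
Proof. by rewrite /kos -sumrN; apply: eq_bigr => j _; ring. Qed.

Lemma kosB f v w J : kos f (fun J => v J - w J) J = kos f v J - kos f w J.
Proof. by rewrite kosD kosN. Qed.

Lemma kosDl f g v J : kos (fun j => f j + g j) v J = kos f v J + kos g v J.
Proof. by rewrite /kos -big_split; apply: eq_bigr => j _ /=; ring. Qed.

Lemma kos_eq0 f v J : (forall j, j \notin J -> v (j |: J) = 0) -> kos f v J = 0.
Proof. by move=> v0; apply: big1 => j /v0 ->; rewrite mulr0. Qed.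

Lemma kos0 f J : kos f (fun=> 0) J = 0.
Proof. exact: kos_eq0. Qed.

(** The contributions of (i, j) and (j, i) cancel: by [sgnU1], inserting i into J flips the sign at
    j exactly when i < j. *)
Lemma kos_kos f v J : kos f (kos f v) J = 0.
Proof.
pose T i j := sgn J i * sgn J j * f i * f j * v (i |: (j |: J)).
have TC i j : T i j = T j i by rewrite /T setUCA; ring.
have -> : kos f (kos f v) J =
    \sum_(i | i \notin J) \sum_(j | (j \notin J) && (i < j)%N) - T i j +
    \sum_(i | i \notin J) \sum_(j | (j \notin J) && (j < i)%N) T i j.
  rewrite -big_split; apply: eq_bigr => i iJ /=.
  rewrite /kos mulr_sumr (bigID (fun j : 'I_n => i < j)%N) /=; congr (_ + _).
    apply: eq_big => [j|j /andP[_ ij]].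
      by rewrite !inE negb_or; have [->|] := eqVneq j i; rewrite ?ltnn ?andbF.
    by rewrite sgnU1 // ij /T setUCA; ring.
  apply: eq_big => [j|j /andP[_ ij]].
    rewrite !inE negb_or; have [->|ne] := eqVneq j i; rewrite ?ltnn ?andbF //=.
    by rewrite -leqNgt ltn_neqAle -val_eqE in ne *; rewrite ne.
  by rewrite sgnU1 // (negPf ij) /T setUCA; ring.
rewrite [X in _ + X](exchange_big_dep (fun j => j \notin J)) /=; last first.
  by move=> i j _ /andP[].
rewrite -big_split big1 // => i iJ /=; rewrite sumrN addrC.
apply/eqP; rewrite subr_eq0; apply/eqP.
by apply: eq_big => [j|j _]; rewrite ?iJ // TC.
Qed.

(** Polarization: expand [kos_kos] for the form f + g. *)
Lemma kos_anticomm f g v J : kos f (kos g v) J = - kos g (kos f v) J.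
Proof.
apply/eqP; rewrite -addr_eq0; apply/eqP.
have := kos_kos (fun j => f j + g j) v J.
rewrite kosDl.
rewrite (@eq_kos f f _ (fun J => kos f v J + kos g v J)) // => [|j _]; last exact: kosDl.
rewrite (@eq_kos g g _ (fun J => kos f v J + kos g v J)) // => [|j _]; last exact: kosDl.
by rewrite !kosD !kos_kos add0r addr0.
Qed.

Definition in_span f S (a : A) := exists b : 'I_n -> A, a = \sum_(j in S) f j * b j.

Lemma in_span0 f S : in_span f S 0.
Proof. by exists (fun=> 0); rewrite big1 // => j _; rewrite mulr0. Qed.

Lemma in_spanD f S a b : in_span f S a -> in_span f S b -> in_span f S (a + b).
Proof.
move=> [c ->] [e ->]; exists (fun j => c j + e j); rewrite -big_split.
by apply: eq_bigr => j _ /=; rewrite mulrDr.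
Qed.

Lemma in_spanM f S a b : in_span f S b -> in_span f S (a * b).
Proof.
move=> [c ->]; exists (fun j => a * c j); rewrite mulr_sumr.
by apply: eq_bigr => j _; rewrite mulrCA.
Qed.

Lemma in_spanN f S a : in_span f S a -> in_span f S (- a).
Proof. by move=> Sa; rewrite -mulN1r; apply: in_spanM. Qed.

Lemma in_span_gen f S j : j \in S -> in_span f S (f j).
Proof.
move=> jS; exists (fun i => (i == j)%:R); rewrite (bigD1 j) //= eqxx mulr1.
by rewrite big1 ?addr0 // => i /andP[_ /negPf->]; rewrite mulr0.
Qed.

Definition supported S v := forall J, ~~ (J \subset S) -> v J = 0.

Definition regular_mod f S m :=
  forall c, in_span f S (f m * c) -> in_span f S c.

(* Exactness in positive degrees of the Koszul complex of the f j, j in S. *)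
Definition acyclic f S := forall v, supported S v -> v set0 = 0 ->
  (forall J, kos f v J = 0) ->
  exists w, [/\ supported S w, w set0 = 0 & forall J, v J = kos f w J].

Lemma supported_kos f S v : supported S v -> supported S (kos f v).
Proof.
move=> vS J JS; apply: kos_eq0 => j _; apply: vS.
by apply: contra JS => /(subset_trans _) ->; rewrite ?subsetU1.
Qed.

Lemma kos_set0 f v : kos f v set0 = \sum_j f j * v [set j].
Proof. by apply: eq_big => [j|j _]; rewrite ?inE // sgn0 mul1r setU0. Qed.

Lemma kos_set0_in_span f S v : supported S v -> in_span f S (kos f v set0).
Proof.
move=> vS; exists (fun j => v [set j]); rewrite kos_set0 (bigID (mem S)) /=.
by rewrite [X in _ + X]big1 ?addr0 // => j jS; rewrite vS ?sub1set ?mulr0.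
Qed.

(** The coefficients expressing [v set0] in the span form a chain u on singletons whose boundary has
    the same value at [set0]; subtracting that boundary reduces to [acyclic]. *)
Lemma acyclic_in_span f S v : acyclic f S -> supported S v -> in_span f S (v set0) ->
  (forall J, kos f v J = 0) ->
  exists w, [/\ supported S w, w set0 = 0 & forall J, v J = kos f w J].
Proof.
move=> acS vS [b v0] dv.
pose u J := \sum_(j in S) (J == [set j])%:R * b j.
have uS : supported S u.
  move=> J JS; apply: big1 => j jS; have [JE|] := eqVneq J [set j]; last by rewrite mul0r.
  by rewrite JE sub1set jS in JS.
have u0 : u set0 = 0.
  apply: big1 => j _; rewrite (_ : _ == _ = false) ?mul0r //.
  by apply/eqP => /setP/(_ j); rewrite !inE eqxx.
have du0 : kos f u set0 = v set0.
  rewrite v0 kos_set0 (bigID (mem S)) /= [X in _ + X]big1 ?addr0 => [|j jS].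
    apply: eq_bigr => j jS; congr (_ * _); rewrite /u (bigD1 j) //= eqxx mul1r.
    rewrite big1 ?addr0 // => i /andP[_ ij]; rewrite (inj_eq set1_inj).
    by rewrite eq_sym (negPf ij) mul0r.
  by rewrite uS ?mulr0 // sub1set.
have [||J|w [wS w0 vw]] := acS (fun J => v J - kos f u J).
- by move=> J JS; rewrite vS // (supported_kos _ uS) // subrr.
- by rewrite du0 subrr.
- by rewrite kosB dv kos_kos subrr.
exists (fun J => w J + u J); split=> [J JS||J].
- by rewrite wS // uS // addr0.
- by rewrite w0 u0 addr0.
- by rewrite kosD -vw subrK.
Qed.

Lemma acyclic_set0 f : acyclic f set0.
Proof.
move=> v vS v0 _; exists (fun=> 0); split=> // J; rewrite kos0.
have [->//|J0] := eqVneq J set0.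
by apply: vS; rewrite subset0.
Qed.

(** * Adjoining one element to a Koszul complex *)

Section Step.

Variables (f : 'I_n -> A) (m : 'I_n).

(** This is v'' in the decomposition v = v' + e_m wedge v'', where v' and v'' do not involve e_m.
    The next two lemmas say that dv = (dv' + f_m v'') - e_m wedge dv''. *)
Definition contr v J := if m \in J then 0 else sgn J m * v (m |: J).

Lemma kosU1 v J : m \notin J -> kos f v (m |: J) = - sgn J m * kos f (contr v) J.
Proof.
move=> mJ; rewrite /kos mulr_sumr [RHS](bigD1 m) //= {1}/contr setU11 !mulr0 add0r.
apply: eq_big => [j|j]; first by rewrite !inE negb_or andbC.
rewrite !inE negb_or => /andP[jm jJ]; rewrite /contr !inE eq_sym (negPf jm) (negPf mJ) /=.
rewrite !sgnU1 // setUCA.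
have [mj|jm'|/val_inj mj] := ltngtP m j; last by rewrite mj eqxx in jm.
  by rewrite -[LHS]mul1r -{1}(sgn_sqr J m) expr1 expr0; ring.
by rewrite -[LHS]mul1r -{1}(sgn_sqr J m) expr1 expr0; ring.
Qed.

Lemma kos_notin v J : m \notin J ->
  kos f v J = f m * contr v J + kos f (fun J => if m \in J then 0 else v J) J.
Proof.
move=> mJ; rewrite /kos [LHS](bigD1 m) //= [in RHS](bigD1 m) //= setU11 mulr0 add0r.
rewrite {1}/contr (negPf mJ); congr (_ + _); first ring.
by apply: eq_bigr => j /andP[jJ jm]; rewrite !inE eq_sym (negPf jm) (negPf mJ).
Qed.

(** For a cycle v = v' + e_m wedge v'', the part v'' is a cycle, and f_m v'' = - dv' in degree 0
    puts v''(set0) in the span by regularity; hence v'' = dw''. With W = - e_m wedge w'' the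
    difference v - dW no longer involves e_m, and acyclicity over S applies to it. *)
Lemma acyclicU1 S : m \notin S -> acyclic f S -> regular_mod f S m -> acyclic f (m |: S).
Proof.
move=> mS acS reg v vS v0 dv.
have v''S : supported S (contr v).
  move=> J JS; rewrite /contr; case: ifP => // /negbT mJ; rewrite vS ?mulr0 //.
  apply: contra JS => /subsetP JS; apply/subsetP=> j jJ.
  by have := JS j; rewrite !inE jJ orbT => /(_ isT)/orP[/eqP jm|//]; rewrite -jm jJ in mJ.
have dv'' J : kos f (contr v) J = 0.
  have [mJ|mJ] := boolP (m \in J).
    apply: kos_eq0 => j _; by rewrite /contr !inE mJ orbT.
  have := kosU1 v mJ; rewrite dv => /(congr1 (fun a => - sgn J m * a)).
  by rewrite mulr0 mulrA mulrNN sgn_sqr mul1r.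
have v'S : supported S (fun J => if m \in J then 0 else v J).
  move=> J JS; case: ifP => // /negbT mJ; apply: vS; apply: contra JS => /subsetP JS.
  apply/subsetP=> j jJ; have := JS j jJ; rewrite !inE => /orP[/eqP jm|//].
  by rewrite -jm jJ in mJ.
have v''0 : in_span f S (contr v set0).
  apply: reg; have := dv set0; rewrite kos_notin ?inE // => /eqP.
  by rewrite addr_eq0 => /eqP->; apply/in_spanN/kos_set0_in_span.
have [w'' [w''S w''0 v''E]] := acyclic_in_span acS v''S v''0 dv''.
pose W J := if m \in J then - sgn (J :\ m) m * w'' (J :\ m) else 0.
have WE J : contr W J = if m \in J then 0 else - w'' J.
  rewrite /contr /W setU11; case: ifP => // /negbT mJ.
  by rewrite setU1K // mulrA mulrN sgn_sqr mulN1r.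
have W0 : W set0 = 0 by rewrite /W inE.
have Win J : m \in J -> kos f W J = v J.
  move=> mJ; rewrite -(setD1K mJ) kosU1 ?setD11 //.
  rewrite (@eq_kos f f _ (fun J => - w'' J)) // => [|j jJ].
    rewrite kosN -v''E /contr setD11 mulNr mulrN opprK mulrA sgn_sqr mul1r.
    by rewrite setD1K.
  rewrite WE; case: ifP => // mU.
  rewrite w''S ?oppr0 //; apply/negP => /subsetP/(_ _ mU); exact/negP.
have Wnotin J : m \notin J -> kos f W J = - f m * w'' J.
  move=> mJ; rewrite kos_notin // WE (negPf mJ) kos_eq0 ?addr0 ?mulrN ?mulNr //.
  by move=> j jJ; case: ifP => // mj; rewrite /W mj.
have [||J|w [wS w0 vw]] := acS (fun J => v J - kos f W J).
- move=> J JS; have [mJ|mJ] := boolP (m \in J); first by rewrite Win ?subrr.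
  by rewrite Wnotin // w''S // mulr0 subr0; have := v'S _ JS; rewrite (negPf mJ).
- by rewrite v0 Wnotin ?inE // w''0 mulr0 subrr.
- by rewrite kosB dv kos_kos subrr.
exists (fun J => w J + W J); split=> [J JS||J].
- have JS' : ~~ (J \subset S).
    by apply: contra JS => /subset_trans->//; apply: subsetUr.
  rewrite wS // add0r /W; case: ifP => // mJ; rewrite w''S ?mulr0 //.
  apply: contra JS => JS; rewrite -(setD1K mJ); exact: setUS.
- by rewrite w0 W0 addr0.
- by rewrite kosD -vw subrK.
Qed.

End Step.

End Koszul.

(** * Strands of the Koszul complex of a pencil *)

(** The hypotheses make the ideal of the f j, j in S, equal to the kernel of [psi]. The quotient
    thus embeds in the domain A, where f m has a nonzero image. *)
Lemma regular_mod_retract (A : idomainType) n (f : 'I_n -> A) (S : {set 'I_n}) m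
    (psi : {rmorphism A -> A}) :
  (forall j, j \in S -> psi (f j) = 0) -> psi (f m) != 0 ->
  (forall a, in_span f S (a - psi a)) -> regular_mod f S m.
Proof.
move=> psi0 psim psiE c [b fmc]; rewrite -(subrK (psi c) c).
apply: in_spanD => //.
have /eqP : psi (f m) * psi c = 0.
  rewrite -rmorphM fmc rmorph_sum big1 // => j jS.
  by rewrite rmorphM /= psi0 // mul0r.
by rewrite mulf_eq0 (negPf psim) => /eqP->; apply: in_span0.
Qed.

Section Pencil.

Variables (R : comNzRingType) (n : nat) (f g : 'I_n -> R).

Definition pencil (f g : 'I_n -> R) j : {poly R} := 'X * (f j)%:P + (g j)%:P.

(** At i = q + 1 this is the Eagon-Northcott expression: [kos f1] of component q plus [kos g1] of
    component q + 1. *)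
Lemma coef_kos_pencil (f1 g1 : 'I_n -> R) (w : {set 'I_n} -> {poly R}) J i :
  (kos (pencil f1 g1) w J)`_i =
  (if i is i'.+1 then kos f1 (fun J => (w J)`_i') J else 0) +
  kos g1 (fun J => (w J)`_i) J.
Proof.
have sgnC j : sgn {poly R} J j = (sgn R J j)%:P by rewrite /sgn rmorphXn rmorphN rmorph1.
have -> : kos (pencil f1 g1) w J =
    kos (fun j => (f1 j)%:P) w J * 'X + kos (fun j => (g1 j)%:P) w J.
  rewrite /kos mulr_suml -big_split; apply: eq_bigr => j _ /=.
  by rewrite /pencil; ring.
have coefC' (e : 'I_n -> R) k :
    (kos (fun j => (e j)%:P) w J)`_k = kos e (fun J => (w J)`_k) J.
  rewrite /kos coef_sum; apply: eq_bigr => j _.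
  by rewrite sgnC -rmorphM /= coefCM.
by rewrite coefD coefMX !coefC'; case: i.
Qed.

(* With V = sum_q (v q) 'X^q, the Koszul differential of V is a + 'X^(k+1) b with a
   and b constant; a and b are boundaries for the pencils f + 'X g and 'X f + g
   respectively, so that, after multiplication by a power of 'X, V differs from a
   boundary by terms of degrees outside the range of interest. *)
Lemma EN_strand_exact k (v : nat -> {set 'I_n} -> R) :
  acyclic (pencil f g) [set: 'I_n] -> acyclic (pencil g f) [set: 'I_n] ->
  (forall q J, (k < q)%N -> v q J = 0) ->
  (forall q (J : {set 'I_n}), (#|J| <= 1)%N -> v q J = 0) ->
  (forall q J, (q < k)%N -> kos f (v q) J + kos g (v q.+1) J = 0) ->
  (forall J, kos f (kos g (v 0)) J = 0) ->
  (forall J, kos g (kos f (v k)) J = 0) ->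
  exists w : nat -> {set 'I_n} -> R,
    forall q J, (q <= k)%N -> v q J = kos f (w q) J + kos g (w q.+1) J.
Proof.
move=> acF acG vk v1 dv fg0 gfk.
have suppT (A : comNzRingType) (u : {set 'I_n} -> A) : supported [set: 'I_n] u.
  by move=> J; rewrite subsetT.
have dv0 (e : 'I_n -> R) q : kos e (v q) set0 = 0.
  by apply: kos_eq0 => j _; apply: v1; rewrite setU0 cards1.
(* A constant chain killed by both forms is a cycle of the pencil: its boundary has only the
   coefficients [kos g1 u] in degree 0 and [kos f1 u] in degree 1. *)
have const (f1 g1 : 'I_n -> R) (u : {set 'I_n} -> R) :
    acyclic (pencil f1 g1) [set: 'I_n] -> u set0 = 0 ->
    (forall J, kos f1 u J = 0) -> (forall J, kos g1 u J = 0) ->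
    exists w : {set 'I_n} -> {poly R}, w set0 = 0 /\
      forall J, (u J)%:P = kos (pencil f1 g1) w J.
  move=> ac u0 fu gu; have [|||w [_ w0 wE]] := ac (fun J => (u J)%:P).
  - exact: suppT.
  - by rewrite u0.
  - move=> J; apply/polyP=> i; rewrite coef_kos_pencil coef0.
    case: i => [|i].
      rewrite add0r -[RHS](gu J); apply: eq_kos => // j _; by rewrite coefC.
    rewrite [X in _ + X]kos_eq0 ?addr0 => [|j _]; last by rewrite coefC.
    case: i => [|i]; last by rewrite kos_eq0 // => j _; rewrite coefC.
    by rewrite -[RHS](fu J); apply: eq_kos => // j _; rewrite coefC.
  by exists w.
have [a [a0 aE]] := const _ _ _ acG (dv0 g 0) (kos_kos _ _) fg0.
have [b [b0 bE]] := const _ _ _ acF (dv0 f k) (kos_kos _ _) gfk.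
have [N aN] : exists N, forall J i, (N <= i)%N -> (a J)`_i = 0.
  exists (\max_J size (a J))%N => J i Ni.
  by rewrite nth_default // (leq_trans _ Ni) // (leq_bigmax J).
(* With y = 'X this is y^N a(1/y). Since y (g/y + f) = y f + g, the reversal exchanges the two
   pencils at the cost of a factor y^(N+1). The constant coefficient of [rev_a] vanishes because a
   has none in degree N. *)
pose rev_a (J : {set 'I_n}) := \poly_(i < N.+1) (a J)`_(N - i).
have rev_aE J : kos (pencil f g) rev_a J = 'X^(N.+1) * (kos g (v 0) J)%:P.
  apply/polyP=> i; rewrite coef_kos_pencil coefXnM coefC.
  have aEi j : (if j is j'.+1 then kos g (fun J => (a J)`_j') J else 0) +
      kos f (fun J => (a J)`_j) J = if j == 0%N then kos g (v 0) J else 0.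
    by rewrite -coef_kos_pencil -aE coefC.
  have [iN|iN|->] := ltngtP i N.+1; last 1 first.
  - rewrite subnn /= -[RHS](aEi 0%N) add0r [X in _ + X]kos_eq0 ?addr0 => [|j _].
      by apply: eq_kos => // j _; rewrite coef_poly ltnSn subnn.
    by rewrite coef_poly ltnn.
  - case: i iN => [|i] iN.
      by rewrite add0r; apply: kos_eq0 => j _; rewrite coef_poly subn0 aN.
    rewrite -[RHS](aEi (N - i.+1).+1) addrC.
    congr (_ + _); apply: eq_kos => // j _; rewrite coef_poly ?iN //.
    by rewrite ltnS ltnW // (_ : N - i = (N - i.+1).+1)%N //; lia.
  - rewrite subn_eq0 leqNgt iN /= kos_eq0 ?addr0 => [|j _].
      case: i iN => [//|i] iN; rewrite kos_eq0 // => j _.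
      by rewrite coef_poly ltnNge -ltnS iN.
    by rewrite coef_poly ltnNge ltnW.
have polyvE J : kos (pencil f g) (fun J => \poly_(q < k.+1) v q J) J =
    (kos g (v 0) J)%:P + 'X^(k.+1) * (kos f (v k) J)%:P.
  have coef_v q (J' : {set 'I_n}) : (\poly_(q < k.+1) v q J')`_q = v q J'.
    by rewrite coef_poly; case: ltnP => // kq; rewrite vk.
  apply/polyP=> i; rewrite coef_kos_pencil coefD coefXnM !coefC.
  have kos_v (e : 'I_n -> R) q :
      kos e (fun J => (\poly_(q < k.+1) v q J)`_q) J = kos e (v q) J.
    by apply: eq_kos => // j _; rewrite coef_v.
  rewrite kos_v; case: i => [|i]; first by rewrite add0r addr0.
  rewrite kos_v add0r; have [ik|ik|->] := ltngtP i k.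
  - by rewrite ltnS ik dv.
  - have [-> ->] : (i.+1 < k.+1)%N = false /\ (i.+1 - k.+1 == 0)%N = false by lia.
    by rewrite !kos_eq0 ?addr0 // => j _; apply: vk; lia.
  - by rewrite ltnn subnn /= [X in _ + X]kos_eq0 ?addr0 // => j _; apply: vk.
(* The corrections cancel the two extreme terms of [polyvE], so V is a cycle. [rev_a] lives in
   degrees at most N and the shifted b in degrees at least N + k + 2, so in degrees N + 1 to N + k +
   1 the coefficients of V are exactly the v q. *)
pose V (J : {set 'I_n}) :=
  'X^(N.+1) * (\poly_(q < k.+1) v q J) - rev_a J - 'X^(N + k.+2) * b J.
have [|||w [_ _ wE]] := acF V.
- exact: suppT.
- rewrite /V b0 mulr0 subr0; apply/eqP; rewrite subr_eq0; apply/eqP/polyP=> i.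
  rewrite coefXnM !coef_poly a0 coef0 v1 ?cards0 //; do 3 case: ifP => //.
- move=> J; rewrite /V (kosB _ (fun J => _ - rev_a J)) (kosB _ _ rev_a) rev_aE.
  rewrite (kosZ _ _ b) (kosZ _ _ (fun J => \poly_(q < k.+1) v q J)) polyvE -bE.
  rewrite addnS -addSn exprD.
  by move: 'X^(N.+1) 'X^(k.+1) => y y'; ring.
(* The coefficient of degree N + 1 + q in the boundary of w involves the coefficients of w in
   degrees N + q and N + q + 1. *)
exists (fun q J => (w J)`_(N + q)) => q J qk.
have := congr1 (fun p : {poly R} => p`_(N.+1 + q)) (wE J).
rewrite coef_kos_pencil addSn addnS => <-.
rewrite /V !coefB !coefXnM !coef_poly.
rewrite (_ : (_ < N.+1)%N = false); last by lia.
rewrite (_ : (_ < N + k.+2)%N = true); last by lia.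
rewrite (_ : (N.+1 + q - N.+1 < k.+1)%N = true); last by lia.
by rewrite !subr0; congr v; lia.
Qed.

End Pencil.

(** * The pencils of the rows of P *)

Section Substitution.

Variables (K : fieldType) (m : nat).

Local Notation A := {poly {mpoly K[m]}}.

Lemma exists_substitution (xi : 'I_m -> A) : exists psi : {rmorphism A -> A},
  [/\ psi 'X = 'X, forall c, psi (c%:MP)%:P = (c%:MP)%:P
    & forall i, psi ('X_i)%:P = xi i].
Proof.
pose constP : {rmorphism K -> A} := polyC \o @mpolyC m K.
pose theta : {rmorphism {mpoly K[m]} -> A} := mmap constP xi.
have cX : commr_rmorph theta 'X by move=> c; apply: mulrC.
exists (horner_morph cX); split=> [|c|i] /=; first exact: horner_morphX.
  by rewrite horner_morphC /theta /= mmapC.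
by rewrite horner_morphC /theta /= mmapX mmap1U.
Qed.

(** The elements congruent to their image under [psi] form a subring, so it is enough to look at
    generators. *)
Lemma substitution_congr (psi : {rmorphism A -> A}) n (f : 'I_n -> A) (S : {set 'I_n}) :
  psi 'X = 'X -> (forall c, psi (c%:MP)%:P = (c%:MP)%:P) ->
  (forall i, in_span f S (('X_i)%:P - psi ('X_i)%:P)) ->
  forall a, in_span f S (a - psi a).
Proof.
move=> psiX psiC psi_var.
pose E a := in_span f S (a - psi a).
have E0 : E 0 by rewrite /E rmorph0 subr0; apply: in_span0.
have ED a b : E a -> E b -> E (a + b).
  by move=> Ea Eb; rewrite /E rmorphD opprD addrACA; apply: in_spanD.
have EM a b : E a -> E b -> E (a * b).
  move=> Ea Eb; rewrite /E rmorphM /=.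
  rewrite (_ : _ - _ = b * (a - psi a) + psi a * (b - psi b)); last by ring.
  by apply: in_spanD; apply: in_spanM.
have E1 : E 1 by rewrite /E rmorph1 subrr; apply: in_span0.
have EX a k : E a -> E (a ^+ k).
  by move=> Ea; elim: k => [|k IH]; rewrite ?expr0 // exprS; apply: EM.
have EC c : E (c%:MP)%:P by rewrite /E psiC subrr; apply: in_span0.
have EV i : E ('X_i)%:P by apply: psi_var.
have EY : E 'X by rewrite /E psiX subrr; apply: in_span0.
suff Ea a : E a by move=> a; apply: Ea.
clearbody E.
have Emp (r : {mpoly K[m]}) : E r%:P.
  elim/mpolyind: r => [|c u p _ _ Ep]; first by rewrite polyC0; apply: E0.
  rewrite polyCD; apply/ED => //; rewrite -mul_mpolyC polyCM; apply/EM => //.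
  rewrite mpolyXE_id rmorph_prod /=; apply: (big_ind E E1 EM) => i _.
  by rewrite rmorphXn; apply/EX/EV.
rewrite -(coefK a) poly_def; apply: (big_ind E E0 ED) => i _.
by rewrite -mul_polyC; apply: EM => //; apply: EX.
Qed.

End Substitution.

Lemma mpolyX_neq0 (K : fieldType) m (u : 'X_{1..m}) : 'X_[u] != 0 :> {mpoly K[m]}.
Proof. by rewrite -msupp_eq0 msuppX. Qed.

Lemma rmorph_pencil (R : comNzRingType) n (f g : 'I_n -> R)
    (psi : {rmorphism {poly R} -> {poly R}}) j :
  psi 'X = 'X -> psi (pencil f g j) = 'X * psi (f j)%:P + psi (g j)%:P.
Proof. by move=> psiX; rewrite rmorphD rmorphM psiX. Qed.

Lemma mulXD_polyC_neq0 (R : nzRingType) (p : {poly R}) c :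
  c != 0 -> 'X * p + c%:P != 0.
Proof.
apply: contra_neq => /(congr1 (fun q : {poly R} => q`_0)).
by rewrite coefD coefXM add0r coefC coef0.
Qed.

Lemma in_span_recurrence (A : comNzRingType) n (f : 'I_n -> A) (S : {set 'I_n})
    (y c e0 e1 : A) k :
  in_span f S (y * e0 + e1) -> in_span f S (e0 - (- y) ^+ k * c) ->
  in_span f S (e1 - (- y) ^+ k.+1 * c).
Proof.
move=> S1 S0; rewrite (_ : _ - _ = y * e0 + e1 - y * (e0 - (- y) ^+ k * c)).
  exact/in_spanD/in_spanN/in_spanM.
by rewrite exprS; ring.
Qed.

Section PencilOfP.

Variables (K : fieldType) (h n : nat).

Local Notation R := {mpoly K[n.+1]}.
Local Notation P := (matP K h n).
Local Notation x i := ('X_(inord i) : R).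

(** The columns of P are the consecutive pairs of this sequence, which extends the first row by
    x_n. *)
Definition entry0 (j : nat) : R := if j == 0%N then 'X_ord0 ^+ h else x j.

Lemma matP0 (j : 'I_n) : P ord0 j = entry0 j.
Proof. by rewrite mxE. Qed.

Lemma matP1 (j : 'I_n) : P ord_max j = x j.+1.
Proof. by rewrite mxE. Qed.

Lemma entry0_neq0 j : entry0 j != 0.
Proof. by rewrite /entry0; case: ifP => _; rewrite ?expf_neq0 // mpolyX_neq0. Qed.

(** Columns are added from the left. Modulo the first m entries, x_i = (-y)^i x_0^h for 0 < i <= m,
    and [xi] substitutes these values. Entry m then keeps the constant coefficient x_(m+1), hence is
    nonzero. *)
Lemma acyclic_pencil01 : acyclic (pencil (P ord0) (P ord_max)) [set: 'I_n].
Proof.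
pose S m := [set j : 'I_n | (j < m)%N].
rewrite (_ : [set: 'I_n] = S n); last by apply/setP=> j; rewrite !inE ltn_ord.
suff acS m : (m <= n)%N -> acyclic (pencil (P ord0) (P ord_max)) (S m) by exact: acS.
elim: m => [|m IH] mn.
  rewrite (_ : S 0%N = set0); first exact: acyclic_set0.
  by apply/setP=> j; rewrite !inE.
pose m' := Ordinal mn.
rewrite (_ : S m.+1 = m' |: S m); last first.
  by apply/setP=> j; rewrite !inE ltnS leq_eqVlt -val_eqE.
apply: acyclicU1; [by rewrite inE ltnn | exact/IH/ltnW | ].
pose xi (i : 'I_n.+1) : {poly R} :=
  if (0 < i <= m)%N then (- 'X) ^+ i * ('X_ord0 ^+ h)%:P else ('X_i)%:P.
have [psi [psiX psiC psi_var]] := exists_substitution xi.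
have xiE i : (0 < i <= m)%N -> xi (inord i) = (- 'X) ^+ i * ('X_ord0 ^+ h)%:P.
  by move=> im; rewrite /xi inordK ?im //; lia.
have xiE' i : (m < i <= n)%N -> xi (inord i) = (x i)%:P.
  by move=> im; rewrite /xi inordK ?ifF //; lia.
have xi0 : xi ord0 = ('X_ord0)%:P by [].
have entryE (j : nat) : (j <= m)%N ->
    psi (entry0 j)%:P = (- 'X) ^+ j * ('X_ord0 ^+ h)%:P.
  move=> jm; rewrite /entry0; case: eqP => [->|j0].
    by rewrite !rmorphXn /= psi_var xi0 mul1r.
  by rewrite psi_var xiE //; lia.
apply: (@regular_mod_retract _ _ _ _ _ psi).
- move=> j; rewrite inE => jm.
  rewrite rmorph_pencil // matP0 matP1 entryE 1?ltnW //.
  by rewrite psi_var xiE ?jm // exprS mulNr mulNr mulrA subrr.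
- rewrite rmorph_pencil // matP0 matP1 entryE //.
  by rewrite psi_var xiE' ?ltnSn // mulXD_polyC_neq0 ?mpolyX_neq0.
- apply: substitution_congr => // i; rewrite psi_var /xi; case: ifP => [|_]; last first.
    by rewrite subrr; apply: in_span0.
  case/andP=> i0 im; have {im} : (i <= m)%N by [].
  have <- : entry0 i = 'X_i by rewrite /entry0 eqn0Ngt i0 inord_val.
  elim: (nat_of_ord i) => [|j IHj] jm.
    by rewrite expr0 mul1r subrr; apply: in_span0.
  apply: (in_span_recurrence _ (IHj (ltnW jm))).
  have jn : (j < n)%N by apply: leq_trans jm (ltnW mn).
  have <- : pencil (P ord0) (P ord_max) (Ordinal jn) =
      'X * (entry0 j)%:P + (entry0 j.+1)%:P.
    by rewrite /pencil matP0 matP1.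
  by apply: in_span_gen; rewrite inE.
Qed.

(** The coefficient 1 now sits on the first row, so columns are added from the right: modulo the
    entries of index at least c, x_i = (-y)^(n-i) x_n for i >= c. As c > 0, the variable x_0 is
    never eliminated; its power x_0^h occurs only in the last column added, as a nonzero constant
    coefficient. *)
Lemma acyclic_pencil10 : acyclic (pencil (P ord_max) (P ord0)) [set: 'I_n].
Proof.
pose S m := [set j : 'I_n | (n - m <= j)%N].
rewrite (_ : [set: 'I_n] = S n); last by apply/setP=> j; rewrite !inE subnn.
suff acS m : (m <= n)%N -> acyclic (pencil (P ord_max) (P ord0)) (S m) by exact: acS.
elim: m => [|m IH] mn.
  rewrite (_ : S 0%N = set0); first exact: acyclic_set0.
  by apply/setP=> j; rewrite !inE subn0 leqNgt ltn_ord.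
pose c := (n - m)%N.
have c0n : (0 < c <= n)%N by lia.
have cn : (c.-1 < n)%N by lia.
have SmE (j : 'I_n) : (j \in S m) = (c <= j)%N by rewrite inE.
pose m' := Ordinal cn.
rewrite (_ : S m.+1 = m' |: S m); last first.
  by apply/setP=> j; rewrite !inE -val_eqE /=; lia.
apply: acyclicU1; [by rewrite SmE /=; lia | exact/IH/ltnW | ].
pose xi (i : 'I_n.+1) : {poly R} :=
  if (c <= i)%N then (- 'X) ^+ (n - i) * (x n)%:P else ('X_i)%:P.
have [psi [psiX psiC psi_var]] := exists_substitution xi.
have xiE i : (c <= i <= n)%N -> xi (inord i) = (- 'X) ^+ (n - i) * (x n)%:P.
  by move=> /andP[ci ni]; rewrite /xi inordK ?ci.
have entryE (j : nat) : (c <= j <= n)%N ->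
    psi (entry0 j)%:P = (- 'X) ^+ (n - j) * (x n)%:P.
  by move=> cj; rewrite /entry0 ifF ?psi_var ?xiE //; lia.
have entryE' (j : nat) : (j < c)%N -> psi (entry0 j)%:P = (entry0 j)%:P.
  move=> jc; rewrite /entry0; case: eqP => [_|j0].
    by rewrite !rmorphXn /= psi_var /xi ifF //=; lia.
  by rewrite psi_var /xi inordK ?ifF //; lia.
apply: (@regular_mod_retract _ _ _ _ _ psi).
- move=> j; rewrite SmE => cj; have jn := ltn_ord j.
  rewrite rmorph_pencil // matP0 matP1 entryE ?cj 1?ltnW //.
  rewrite psi_var xiE ?(leq_trans cj) //= (_ : n - j = (n - j.+1).+1)%N; last by lia.
  by rewrite exprS; ring.
- rewrite rmorph_pencil // matP0 matP1 entryE'; last by rewrite /m' /=; lia.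
  exact/mulXD_polyC_neq0/entry0_neq0.
- apply: substitution_congr => // i; rewrite psi_var /xi; case: ifP => [ci|_]; last first.
    by rewrite subrr; apply: in_span0.
  have [in_ iE] : (i <= n)%N /\ 'X_i = x (n - (n - i)) :> R.
    by rewrite subKn ?inord_val -1?ltnS.
  have : (c <= n - (n - i))%N by rewrite subKn.
  rewrite iE; elim: (n - i)%N => [|e IHe] ce.
    by rewrite subn0 expr0 mul1r subrr; apply: in_span0.
  apply: (@in_span_recurrence _ _ _ _ _ _ (x (n - e))%:P); last by apply: IHe; lia.
  have jn : (n - e.+1 < n)%N by lia.
  have -> : 'X * (x (n - e))%:P + (x (n - e.+1))%:P =
      pencil (P ord_max) (P ord0) (Ordinal jn).
    rewrite /pencil matP0 matP1 /entry0 /= ifF; last by lia.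
    by rewrite (_ : n - e = (n - e.+1).+1)%N //; lia.
  by apply: in_span_gen; rewrite SmE.
Qed.

End PencilOfP.

(** * Exactness of the Eagon-Northcott complex *)

Section EagonNorthcottExact.

Variables (R : comNzRingType) (n : nat) (P : 'M[R]_(2, n)).

Local Notation f := (P ord0).
Local Notation g := (P ord_max).
Local Notation basis k := ('I_k.+1 * wedge_basis n k.+2)%type.
Local Notation chain k := {ffun basis k -> R}.
Local Notation d k := (free_map (@EN_diff R n P k.+1)).

(* The coefficient of (g_0^(k-q) g_1^q)^* (x) e_J, and 0 if k < q or #|J| != k+2. *)
Definition component k (v : chain k) (q : nat) (J : {set 'I_n}) : R :=
  \sum_(b : basis k | (b.1 == q :> nat) && (val b.2 == J)) v b.

Lemma component_basis k (v : chain k) (b : basis k) : component v b.1 (val b.2) = v b.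
Proof.
rewrite /component (eq_bigl (pred1 b)) ?big_pred1_eq //.
Qed.

Lemma component_gt k (v : chain k) q J : (k < q)%N -> component v q J = 0.
Proof.
move=> kq; apply: big1 => b /andP[/eqP bq _]; have := ltn_ord b.1.
by rewrite bq ltnS leqNgt kq.
Qed.

Lemma component_card k (v : chain k) q (J : {set 'I_n}) :
  #|J| != k.+2 -> component v q J = 0.
Proof.
move=> Jk; apply: big1 => b /andP[_ /eqP bJ].
by rewrite -bJ (eqP (valP b.2)) eqxx in Jk.
Qed.

Lemma component_ffun k (w : nat -> {set 'I_n} -> R) q (J : {set 'I_n}) :
  (q <= k)%N -> #|J| = k.+2 ->
  component ([ffun b : basis _ => w b.1 (val b.2)] : chain k) q J = w q J.
Proof.
rewrite -ltnS => qk /eqP Jk.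
pose b : basis k := (Ordinal qk, exist _ J Jk).
by rewrite -[RHS](ffunE (fun b : basis k => w b.1 (val b.2)) b) -component_basis.
Qed.

(** Indexing by the j outside J' instead of the j in J gives the shape of [kos]; the sign is
    unchanged because j is not counted below itself. *)
Lemma EN_coefE q J q' J' : EN_coef P q J q' J' =
  \sum_(i < 2) \sum_(j | j \notin J')
    (if (q == (q' + i)%N) && (J == j |: J') then sgn R J' j * P i j else 0).
Proof.
rewrite exchange_big /= /EN_coef big_mkcond [RHS]big_mkcond; apply: eq_bigr => j _.
have -> : (j \in J) && (J' == J :\ j) = (j \notin J') && (J == j |: J').
  apply/andP/andP => -[jJ /eqP ->]; first by rewrite setD11 setD1K.
  by rewrite setU11 setU1K.
case: (boolP (j \in J')) => //= jJ'; case: eqP => [->|_]; last first.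
  by rewrite big1 // => i _; rewrite andbF.
rewrite big_mkcond; apply: eq_bigr => i _; rewrite andbT.
by rewrite -/(sgn R (j |: J') j) sgnU1 // ltnn mul1r.
Qed.

(** In [EN_coef] the row i links component q' + i to component q': the row f acts on the component
    of the same index, the row g on the next one. *)
Lemma free_map_EN k (v : chain k.+1) (b : basis k) :
  d k v b = kos f (component v b.1) (val b.2) + kos g (component v b.1.+1) (val b.2).
Proof.
rewrite ffunE /=; under eq_bigr do rewrite EN_coefE mulr_sumr.
rewrite exchange_big /=.
have E (i : 'I_2) : \sum_(b0 : basis k.+1)
    v b0 * (\sum_(j | j \notin val b.2)
      (if (b0.1 == (b.1 + i)%N :> nat) && (val b0.2 == j |: val b.2)
       then sgn R (val b.2) j * P i j else 0)) =
    kos (P i) (component v (b.1 + i)) (val b.2).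
  under eq_bigr do rewrite mulr_sumr.
  rewrite exchange_big; apply: eq_bigr => j _.
  rewrite /component mulr_sumr [RHS]big_mkcond; apply: eq_bigr => b0 _.
  by case: ifP => _; rewrite ?mulr0 // mulrC.
rewrite big_ord_recl big_ord1 (E ord0) (E (lift ord0 ord0)) addn0 addn1.
by congr (_ + kos (P _) _ _); apply: val_inj.
Qed.

(** The bound on q matters: at q = k + 1 the right side would still contain [kos f] of the top
    component, which the complex drops. *)
Lemma component_free_map k (v : chain k.+1) q J : (q <= k)%N ->
  component (d k v) q J = kos f (component v q) J + kos g (component v q.+1) J.
Proof.
rewrite -ltnS => qk; have [Jk|Jk] := boolP (#|J| == k.+2).
  have /= <- := free_map_EN v (Ordinal qk, exist _ J Jk).
  by rewrite -component_basis.
rewrite component_card // !kos_eq0 ?addr0 // => j jJ;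
  by rewrite component_card // cardsU1 jJ.
Qed.

Lemma component_cycle k (v : chain k.+1) : d k v = 0 <->
  forall q J, (q <= k)%N -> kos f (component v q) J + kos g (component v q.+1) J = 0.
Proof.
split=> [dv q J qk|dv].
  rewrite -component_free_map // dv; apply: big1 => b _; exact: ffunE.
by apply/ffunP => b; rewrite free_map_EN dv ?ffunE // -ltnS ltn_ord.
Qed.

Lemma minor2E j1 j2 : minor2 P j1 j2 = f j1 * g j2 - f j2 * g j1.
Proof.
rewrite /minor2; set M := row_mx _ _.
have E i (k : 'I_2) : (M : 'M_2) i k = P i (if k == ord0 then j1 else j2).
  rewrite mxE; case: splitP => l kl; rewrite mxE; case: eqP => // k0.
    by case: k0; apply: val_inj; rewrite /= kl ord1.
  by rewrite k0 in kl.
rewrite (expand_det_row _ ord0) big_ord_recl big_ord1 /cofactor !det_mx11.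
clearbody M; rewrite !mxE !E /= (_ : lift _ _ = ord_max); last exact: val_inj.
by rewrite addn0 expr0 expr1; ring.
Qed.

(** Contracting by g and then by f pairs u with f wedge g up to sign, and the coefficients of f
    wedge g are the minors. This expresses wedge^2 alpha through [kos]. *)
Lemma kos_kos_set0 (u : {set 'I_n} -> R) : kos f (kos g u) set0 =
  - \sum_(j1 < n) \sum_(j2 < n | (j1 < j2)%N) minor2 P j1 j2 * u [set j1; j2].
Proof.
have -> : kos f (kos g u) set0 =
    \sum_(i < n) \sum_(j < n | (i < j)%N) - (f i * g j * u [set i; j]) +
    \sum_(i < n) \sum_(j < n | (j < i)%N) f i * g j * u [set i; j].
  rewrite kos_set0 -big_split; apply: eq_bigr => i _ /=.
  rewrite /kos mulr_sumr (bigID (fun j : 'I_n => i < j)%N) /=.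
  have sgnE j : sgn R [set i] j = (-1) ^+ (i < j)%N.
    by rewrite -[[set i]]setU0 sgnU1 ?inE // sgn0 mulr1.
  congr (_ + _); apply: eq_big => [j|j /andP[_ ij]].
  - by rewrite !inE; have [->|] := eqVneq j i; rewrite ?ltnn ?andbF.
  - by rewrite sgnE ij setUC; ring.
  - rewrite !inE; have [->|ne] := eqVneq j i; rewrite ?ltnn ?andbF //=.
    by rewrite -leqNgt ltn_neqAle -val_eqE in ne *; rewrite ne.
  - by rewrite sgnE (negPf ij) setUC; ring.
rewrite [X in _ + X](exchange_big_dep xpredT) //= -big_split -sumrN /=.
apply: eq_bigr => i _; rewrite -big_split -sumrN /=; apply: eq_bigr => j _.
by rewrite minor2E [[set j; i]]setUC; ring.
Qed.

Lemma augmentation_EN (v : chain 0) :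
  augmentation (fun b => @EN_diff R n P 0 b tt) v =
  - kos f (kos g (component v 0)) set0.
Proof.
rewrite kos_kos_set0 opprK /augmentation /= /wedge2.
under eq_bigr do rewrite big_mkcond mulr_sumr.
rewrite exchange_big; apply: eq_bigr => j1 _ /=.
transitivity (\sum_(b : basis 0) \sum_(j2 < n | (j1 < j2)%N)
   (if (j1 \in val b.2) && (j2 \in val b.2) then v b * minor2 P j1 j2 else 0)).
  apply: eq_bigr => b _; case: (j1 \in _); last by rewrite mulr0 big1.
  rewrite mulr_sumr [LHS]big_mkcond [RHS]big_mkcond; apply: eq_bigr => j2 _ /=.
  by case: (j2 \in _); case: (_ < _)%N.
rewrite exchange_big; apply: eq_bigr => j2 j12 /=.
rewrite /component mulr_sumr [RHS]big_mkcond; apply: eq_bigr => -[q b] _ /=.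
have -> : (j1 \in val b) && (j2 \in val b) = (q == 0%N :> nat) && (val b == [set j1; j2]).
  rewrite ord1 /= [RHS]eq_sym eqEcard (eqP (valP b)) cards2.
  rewrite -val_eqE (ltn_eqF j12) /= andbT.
  apply/andP/subsetP => [[b1 b2] x /set2P[]->//|sub].
  by split; apply: sub; rewrite !inE eqxx ?orbT.
by case: ifP; rewrite // mulrC.
Qed.

(** Only J = [set0] has content: two insertions into a nonempty J give a set of more than two
    elements, where the component is 0. *)
Lemma augmentation_component (v : chain 0) :
  augmentation (fun b => @EN_diff R n P 0 b tt) v = 0 <->
  forall J, kos f (kos g (component v 0)) J = 0.
Proof.
rewrite augmentation_EN; split=> [/eqP|->]; last by rewrite oppr0.
rewrite oppr_eq0 => /eqP v0 J; have [->//|J0] := eqVneq J set0.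
apply: kos_eq0 => i iJ; apply: kos_eq0 => j ji; apply: component_card.
by rewrite !cardsU1 ji iJ !add1n eqSS eqSS cards_eq0.
Qed.

Lemma EN_dd k (v : chain k.+2) : d k (d k.+1 v) = 0.
Proof.
apply/component_cycle => q J qk.
rewrite (@eq_kos _ _ f f _
    (fun J => kos f (component v q) J + kos g (component v q.+1) J)) //;
  last by move=> j _; rewrite component_free_map // ltnW.
rewrite (@eq_kos _ _ g g _
    (fun J => kos f (component v q.+1) J + kos g (component v q.+2) J)) //;
  last by move=> j _; rewrite component_free_map.
by rewrite !kosD !kos_kos kos_anticomm; ring.
Qed.

Lemma augmentation_d (v : chain 1) :
  augmentation (fun b => @EN_diff R n P 0 b tt) (d 0 v) = 0.
Proof.
apply/augmentation_component => J; rewrite kos_anticomm.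
rewrite (@eq_kos _ _ g g _ (fun J => - kos g (kos f (component v 1)) J)) //.
  by rewrite kosN kos_kos !oppr0.
move=> j _; rewrite -kos_anticomm.
rewrite (@eq_kos _ _ f f _
    (fun J => kos f (component v 0) J + kos g (component v 1) J)) //;
  last by move=> i _; rewrite component_free_map.
by rewrite kosD kos_kos add0r.
Qed.

Hypothesis acFG : acyclic (pencil f g) [set: 'I_n].
Hypothesis acGF : acyclic (pencil g f) [set: 'I_n].

(** Common form of exactness at the augmentation and in higher degrees. For k = 0 the first
    condition is vacuous and the other two agree up to sign; for k > 0 they follow from the first,
    as in [EN_exact]. *)
Lemma EN_boundary k (v : chain k) :
  (forall q J, (q < k)%N -> kos f (component v q) J + kos g (component v q.+1) J = 0) ->
  (forall J, kos f (kos g (component v 0)) J = 0) ->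
  (forall J, kos g (kos f (component v k)) J = 0) ->
  exists z, v = d k z.
Proof.
move=> dv v0 vk.
have [q J|q J J1|w wE] := EN_strand_exact acFG acGF _ _ dv v0 vk.
- exact: component_gt.
- by apply: component_card; apply/eqP => Jk; rewrite Jk in J1.
exists [ffun b : basis _ => w b.1 (val b.2)]; apply/ffunP => b; rewrite free_map_EN.
have bk : (b.1 <= k)%N by rewrite -ltnS ltn_ord.
rewrite -component_basis wE //; congr (_ + _); apply: eq_kos => // j jb.
  by rewrite component_ffun 1?ltnW // cardsU1 jb (eqP (valP b.2)).
by rewrite component_ffun // cardsU1 jb (eqP (valP b.2)).
Qed.

Lemma EN_exact k (v : chain k.+1) : d k v = 0 <-> exists z, v = d k.+1 z.
Proof.
split=> [/component_cycle dv|[z ->]]; last exact: EN_dd.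
apply: EN_boundary => [||J]; first by move=> q J; apply: dv.
- move=> J; rewrite kos_anticomm.
  rewrite (@eq_kos _ _ g g _ (fun J => - kos g (component v 1) J)) //.
    by rewrite kosN kos_kos !oppr0.
  by move=> j _; apply/eqP; rewrite -addr_eq0; apply/eqP/dv.
- rewrite kos_anticomm (@eq_kos _ _ f f _ (fun J => - kos f (component v k) J)) //.
    by rewrite kosN kos_kos !oppr0.
  by move=> j _; apply/eqP; rewrite -addr_eq0 addrC; apply/eqP/dv.
Qed.

Lemma EN_augmentation_exact (v : chain 0) :
  augmentation (fun b => @EN_diff R n P 0 b tt) v = 0 <-> exists z, v = d 0 z.
Proof.
split=> [/augmentation_component v0|[z ->]]; last exact: augmentation_d.
apply: EN_boundary => // J.
by rewrite kos_anticomm v0 oppr0.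
Qed.

End EagonNorthcottExact.

(** * The defining ideal and the grading *)

Section IdealGen.

Variables (R : comNzRingType) (S : R -> Prop).

Lemma ideal_gen0 : ideal_gen S 0.
Proof. by exists 0%N, (fun=> 0), (fun=> 0); split=> [[]|]; rewrite ?big_ord0. Qed.

Lemma ideal_gen_mem p : S p -> ideal_gen S p.
Proof. by move=> Sp; exists 1%N, (fun=> 1), (fun=> p); rewrite big_ord1 mul1r. Qed.

Lemma ideal_genD p q : ideal_gen S p -> ideal_gen S q -> ideal_gen S (p + q).
Proof.
move=> [l1 [c1 [s1 [S1 ->]]]] [l2 [c2 [s2 [S2 ->]]]].
pose glue (u1 : 'I_l1 -> R) (u2 : 'I_l2 -> R) k :=
  match split k with inl i => u1 i | inr i => u2 i end.
exists (l1 + l2)%N, (glue c1 c2), (glue s1 s2); split=> [i|].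
  by rewrite /glue; case: split.
rewrite big_split_ord /=; congr (_ + _); apply: eq_bigr => i _.
  by rewrite /glue (unsplitK (inl i)).
by rewrite /glue (unsplitK (inr i)).
Qed.

Lemma ideal_genM p q : ideal_gen S q -> ideal_gen S (p * q).
Proof.
move=> [l [c [s [Ss ->]]]]; exists l, (fun i => p * c i), s; split=> //.
by rewrite mulr_sumr; apply: eq_bigr => i _; rewrite mulrA.
Qed.

Lemma ideal_gen_sum (I : finType) (Q : pred I) F :
  (forall i, Q i -> ideal_gen S (F i)) -> ideal_gen S (\sum_(i | Q i) F i).
Proof. by move=> SF; apply: big_ind => //; [apply: ideal_gen0|apply: ideal_genD]. Qed.

Lemma ideal_genN p : ideal_gen S p -> ideal_gen S (- p).
Proof. by move=> Sp; rewrite -mulN1r; apply: ideal_genM. Qed.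

End IdealGen.

Section Wedge2.

Variables (R : comNzRingType) (n : nat) (P : 'M[R]_(2, n)).

Lemma wedge2_pair (j1 j2 : 'I_n) : (j1 < j2)%N ->
  wedge2 P [set j1; j2] = minor2 P j1 j2.
Proof.
move=> j12; have ne : j1 \notin [set j2] by rewrite inE -val_eqE (ltn_eqF j12).
rewrite /wedge2; under eq_bigr do rewrite big_mkcondr big_setU1 //= big_set1.
by rewrite big_setU1 //= big_set1 !ltnn j12 ltnNge (ltnW j12) /= !addr0 add0r.
Qed.

Lemma ideal_minors2_augmentation p : ideal_minors2 P p <->
  exists v, p = augmentation (fun b => @EN_diff R n P 0 b tt) v.
Proof.
pose E x := exists v, x = augmentation (fun b => @EN_diff R n P 0 b tt) v.
have ED x y : E x -> E y -> E (x + y).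
  move=> [v ->] [v' ->]; exists (v + v'); rewrite /augmentation -big_split.
  by apply: eq_bigr => b _; rewrite ffunE /= mulrDl.
have E0 : E 0.
  by exists 0; rewrite /augmentation big1 // => b _; rewrite ffunE mul0r.
split=> [[l [c [s [Ss ->]]]]|[v ->]].
  apply: (big_ind E) => // i _; have [j1 [j2 [j12 ->]]] := Ss i.
  have Jk : #|[set j1; j2]| == 2%N by rewrite cards2 -val_eqE (ltn_eqF j12).
  pose b : EN_basis n 1 := (ord0, exist (fun J : {set 'I_n} => #|J| == 2%N) _ Jk).
  exists [ffun b' => if b' == b then c i else 0].
  rewrite /augmentation (bigD1 b) //= ffunE eqxx wedge2_pair // big1 ?addr0 // => b' b'b.
  by rewrite ffunE (negPf b'b) mul0r.
apply: ideal_gen_sum => b _; apply: ideal_genM.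
apply: ideal_gen_sum => j1 _; apply: ideal_gen_sum => j2 /andP[_ j12].
by apply: ideal_gen_mem; exists j1, j2.
Qed.

End Wedge2.

Section Grading.

Variables (K : fieldType) (m : nat) (w : 'I_m -> 'X_{1..2}).

Lemma wdegD u v : wdeg w (u + v)%MM = (wdeg w u + wdeg w v)%MM.
Proof.
rewrite /wdeg -big_split; apply: eq_bigr => i _; apply/mnmP => l.
by rewrite !(mnmDE, mulmnE) mulnDr.
Qed.

Lemma wdegU i : wdeg w U_(i)%MM = w i.
Proof.
rewrite /wdeg (bigD1 i) //= mnm1E eqxx mulm1n big1 ?addm0 // => j ji.
by rewrite mnm1E eq_sym (negPf ji) mulm0n.
Qed.

Lemma wdegMn u k : wdeg w (u *+ k)%MM = (wdeg w u *+ k)%MM.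
Proof.
elim: k => [|k IH]; last by rewrite !mulmS wdegD IH.
by rewrite !mulm0n /wdeg big1 // => i _; rewrite mnm0E mulm0n.
Qed.

Definition homogeneous (p : {mpoly K[m]}) gamma :=
  forall u, u \in msupp p -> wdeg w u = gamma.

Lemma homogeneousX u : homogeneous 'X_[u] (wdeg w u).
Proof. by move=> v; rewrite msuppX inE => /eqP->. Qed.

Lemma homogeneous0 gamma : homogeneous 0 gamma.
Proof. by move=> v; rewrite msupp0. Qed.

Lemma homogeneousD p q gamma :
  homogeneous p gamma -> homogeneous q gamma -> homogeneous (p + q) gamma.
Proof.
by move=> hp hq u /msuppD_le; rewrite mem_cat => /orP[/hp|/hq].
Qed.

Lemma homogeneousM p q gamma delta :
  homogeneous p gamma -> homogeneous q delta -> homogeneous (p * q) (gamma + delta)%MM.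
Proof.
by move=> hp hq u /msuppM_le/allpairsP[[u1 u2] /= [/hp <- /hq <- ->]]; apply: wdegD.
Qed.

Lemma homogeneousN p gamma : homogeneous p gamma -> homogeneous (- p) gamma.
Proof. by move=> hp u; rewrite (perm_mem (msuppN _)); apply: hp. Qed.

Lemma homogeneous_sum (I : finType) (Q : pred I) F gamma :
  (forall i, Q i -> homogeneous (F i) gamma) ->
  homogeneous (\sum_(i | Q i) F i) gamma.
Proof.
move=> hF; apply: (big_ind (fun p => homogeneous p gamma)) => //.
  exact: homogeneous0.
by move=> p q; apply: homogeneousD.
Qed.

Lemma homogeneous_sign p gamma k :
  homogeneous p gamma -> homogeneous ((-1) ^+ k * p) gamma.
Proof.
by move=> hp; rewrite -signr_odd mulr_sign; case: ifP => // _; apply: homogeneousN.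
Qed.

(* A p killed by phi whose support contains u also contains a second monomial u'
   of the same degree; subtracting a multiple of x^u - x^u' shrinks the support. *)
Lemma defining_ideal_binomials (S : {mpoly K[m]} -> Prop) :
  (forall u u', wdeg w u = wdeg w u' -> ideal_gen S ('X_[u] - 'X_[u'])) ->
  forall p, defining_ideal K w p -> ideal_gen S p.
Proof.
move=> Sbin p; have [k] := ubnP (size (msupp p)); elim: k p => // k IH p pk p0.
have [->|] := eqVneq p 0; first exact: ideal_gen0.
rewrite -msupp_eq0; case sp: (msupp p) => [//|u s] _.
have us : u \in msupp p by rewrite sp mem_head.
have phiE q : phi w q = \sum_(v <- msupp q) q@_v *: 'X_[wdeg w v].
  rewrite {1}(mpolyE q) /phi raddf_sum /=; apply: eq_bigr => v _.
  by rewrite comp_mpolyZ -/(phi w _) phi_monomial.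
have [/hasP[u' u's /andP[u'u /eqP degu']]|nou'] :=
    boolP (has (fun u' => (u' != u) && (wdeg w u' == wdeg w u)) (msupp p)); last first.
  (* Without a second monomial of this degree, the coefficient of [phi w p] there is [p@_u], which
     is nonzero. *)
  have : (phi w p)@_(wdeg w u) = 0 by rewrite p0 mcoeff0.
  rewrite phiE raddf_sum /= (bigD1_seq u) ?msupp_uniq //= mcoeffZ mcoeffX eqxx mulr1.
  rewrite big_seq_cond big1 ?addr0 => [/eqP|v /andP[vs vu]].
    by rewrite mcoeff_eq0 us.
  rewrite mcoeffZ mcoeffX; case: eqP => [vE|_]; last by rewrite mulr0.
  by case/hasP: nou'; exists v; rewrite // vu vE eqxx.
set q := p - p@_u *: ('X_[u] - 'X_[u']).
have qE v : q@_v = p@_v - p@_u * ((u == v)%:R - (u' == v)%:R).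
  by rewrite mcoeffB mcoeffZ mcoeffB !mcoeffX.
have qsub : {subset msupp q <= rem u (msupp p)}.
  move=> v; rewrite mem_rem_uniq ?msupp_uniq // inE -[v \in msupp q]negbK.
  rewrite -mcoeff_eq0 qE => nz; apply/andP; split.
    by apply: contraNneq nz => ->; rewrite eqxx (negPf u'u) subr0 mulr1 subrr.
  apply: contraNT nz => vp; rewrite (eqP _ : p@_v = 0) ?mcoeff_eq0 //.
  have /negPf-> : u != v by apply: contraNneq vp => <-.
  have /negPf-> : u' != v by apply: contraNneq vp => <-.
  by rewrite subrr mulr0 subrr.
rewrite -(subrK (p@_u *: ('X_[u] - 'X_[u'])) p) -/q -mul_mpolyC.
apply: ideal_genD; last by apply/ideal_genM/Sbin.
apply: IH.
  apply: leq_ltn_trans (uniq_leq_size (msupp_uniq q) qsub) _.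
  by rewrite size_rem // prednK ?sp // -ltnS -sp.
rewrite /defining_ideal /phi raddfB /= comp_mpolyZ raddfB /= -!/(phi w _).
by rewrite p0 !phi_monomial degu' subrr scaler0 subr0.
Qed.

End Grading.

(** * Homogeneity and minimality for the matrix P *)

Section PencilMatrix.

Variables (K : fieldType) (h n : nat) (a d : 'X_{1..2}).
Hypothesis h_gt0 : (0 < h)%N.
Hypothesis n_gt1 : (1 < n)%N.
Hypothesis free_ad : free [:: vecQ a; vecQ d].

Local Notation R := {mpoly K[n.+1]}.
Local Notation P := (matP K h n).
Local Notation g := (gens a d h n).
Local Notation c := (col_degree a d h n).
Local Notation r := (row_degree d).

Definition entry_exp k : 'X_{1..n.+1} :=
  if k == 0%N then (U_(ord0) *+ h)%MM else U_(inord k)%MM.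

Lemma matP_X i j : P i j = 'X_[entry_exp (i + j)%N].
Proof. by rewrite mxE /entry_exp; case: ifP => // _; rewrite mpolyXn. Qed.

Lemma wdeg_entry_exp k : (k <= n)%N -> wdeg g (entry_exp k) = (a *+ h + d *+ k)%MM.
Proof.
rewrite /entry_exp; case: eqP => [->|/eqP k0] kn.
  by rewrite wdegMn wdegU mulm0n addm0.
by rewrite wdegU /gens -val_eqE /= inordK // (negPf k0).
Qed.

Lemma matP_homogeneous i (j : 'I_n) : homogeneous g (P i j) (c j + r i)%MM.
Proof.
rewrite matP_X; have -> : (c j + r i)%MM = wdeg g (entry_exp (i + j)%N).
  rewrite wdeg_entry_exp; last by have := ltn_ord i; have := ltn_ord j; lia.
  by apply/mnmP=> l; rewrite !(mnmDE, mulmnE); lia.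
exact: homogeneousX.
Qed.

Lemma matP_irrelevant i j : irrelevant_ideal (P i j).
Proof.
rewrite mxE; case: ifP => _; last by apply: ideal_gen_mem; eexists.
rewrite -(prednK h_gt0) exprSr; apply: ideal_genM; apply: ideal_gen_mem.
by exists ord0.
Qed.

Lemma minor2_homogeneous j1 j2 :
  homogeneous g (minor2 P j1 j2) (c j1 + c j2 + d)%MM.
Proof.
have r0 : r ord0 = 0%MM by rewrite /row_degree mulm0n.
have r1 : r ord_max = d by rewrite /row_degree mulm1n.
rewrite minor2E; apply: homogeneousD.
  have -> : (c j1 + c j2 + d = (c j1 + r ord0) + (c j2 + r ord_max))%MM.
    by rewrite r0 r1 addm0 addmA.
  by apply: homogeneousM; apply: matP_homogeneous.
apply: homogeneousN.
have -> : (c j1 + c j2 + d = (c j2 + r ord0) + (c j1 + r ord_max))%MM.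
  by rewrite r0 r1 addm0 addmA [(c j1 + _)%MM]addmC.
by apply: homogeneousM; apply: matP_homogeneous.
Qed.

Lemma EN_augmentation_homogeneous b :
  homogeneous g (@EN_diff R n P 0 b tt) (EN_twist c r b).
Proof.
case: b => -[[|//] q0] [J /= Jk]; rewrite /wedge2.
apply: homogeneous_sum => j1 j1J; apply: homogeneous_sum => j2 /andP[j2J j12].
have -> : J = [set j1; j2].
  apply/esym/eqP; rewrite eqEcard (eqP Jk) cards2 -val_eqE (ltn_eqF j12) andbT.
  by apply/subsetP => x /set2P[]->.
rewrite big_setU1 /=; last by rewrite inE -val_eqE (ltn_eqF j12).
rewrite big_set1 => u /minor2_homogeneous ->; apply/mnmP => l.
by rewrite !(mnmDE, mulmnE) /=; lia.
Qed.

(** Removing j from J lowers the column part of the twist by the degree of column j, and q = q' + i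
    lowers the row part by that of row i; together this is the degree of [P i j]. *)
Lemma EN_diff_homogeneous k b b' u :
  u \in msupp (@EN_diff R n P k.+1 b b') ->
  (wdeg g u + EN_twist c r b')%MM = EN_twist c r b.
Proof.
case: b b' => [q [J Jk]] [q' [J' J'k]] /= uP.
rewrite /EN_coef in uP.
case/msupp_sum_le/flattenP: uP => _ /mapP[j + ->].
rewrite mem_filter => /andP[/andP[jJ /eqP ->] _].
case/msupp_sum_le/flattenP => _ /mapP[i + ->].
rewrite mem_filter => /andP[/eqP -> _].
move/(homogeneous_sign (@matP_homogeneous i j)) => ->.
rewrite [in RHS](big_setD1 j) //=; apply/mnmP => l.
rewrite /col_degree /row_degree /= mulm0n mulm1n !(mnmDE, mulmnE, mnm0E). lia.
Qed.

Lemma EN_diff_minimal k b b' : irrelevant_ideal (@EN_diff R n P k.+1 b b').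
Proof.
apply: ideal_gen_sum => j _; apply: ideal_gen_sum => i _; apply: ideal_genM.
exact: matP_irrelevant.
Qed.


(** * Normal forms of monomials modulo the minors *)

Definition middle (u : 'X_{1..n.+1}) : nat := \sum_(k < n.+1 | (0 < k < n)%N) u k.

Lemma middleD u v : middle (u + v)%MM = (middle u + middle v)%N.
Proof. by rewrite /middle -big_split; apply: eq_bigr => k _; rewrite mnmDE. Qed.

Lemma middleU i : middle U_(i)%MM = (0 < i < n)%N.
Proof.
rewrite /middle; have [im|im] := boolP (0 < i < n)%N.
  rewrite (bigD1 i) //= mnm1E eqxx big1 ?addn0 // => k /andP[_ ki].
  by rewrite mnm1E eq_sym (negPf ki).
rewrite big1 // => k km; rewrite mnm1E; case: eqP => // ik.
by rewrite ik km in im.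
Qed.

Lemma middle_gt0 u : (0 < middle u)%N ->
  exists (i : 'I_n.+1) w, (0 < i < n)%N /\ u = (U_(i) + w)%MM.
Proof.
rewrite lt0n sum_nat_eq0 negb_forall => /existsP[i]; rewrite negb_imply => /andP[im ui].
by exists i, (u - U_(i))%MM; rewrite addmC submK // lep1mP.
Qed.

Lemma middle_gt1 u : (1 < middle u)%N ->
  exists (i j : 'I_n.+1) w, [/\ (0 < i <= j)%N, (j < n)%N & u = (U_(i) + (U_(j) + w))%MM].
Proof.
move=> u2; have [i [v [im uE]]] := middle_gt0 (ltnW u2).
have [|j [w [jm vE]]] := @middle_gt0 v.
  by move: u2; rewrite uE middleD middleU im.
have [ij|ji] := leqP i j.
  by exists i, j, w; rewrite uE vE ij andbT; case/andP: im => ->; case/andP: jm.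
exists j, i, w; rewrite uE vE (ltnW ji) andbT.
case/andP: im => _ ->; case/andP: jm => -> _.
by split=> //; apply/mnmP => l; rewrite !mnmDE addnCA.
Qed.

(* The value decreases strictly under x_i x_j -> x_(i-1) x_(j+1) for i <= j. *)
Definition spread (u : 'X_{1..n.+1}) : nat := \sum_(k < n.+1) u k * (k * (n - k)).

Lemma spreadD u v : spread (u + v)%MM = (spread u + spread v)%N.
Proof. by rewrite /spread -big_split; apply: eq_bigr => k _; rewrite mnmDE mulnDl. Qed.

Lemma spreadU (i : 'I_n.+1) : spread U_(i)%MM = (i * (n - i))%N.
Proof.
rewrite /spread (bigD1 i) //= mnm1E eqxx mul1n big1 ?addn0 // => k ki.
by rewrite mnm1E eq_sym (negPf ki) mul0n.
Qed.

(** The weight vanishes at k = 0, so x_0^h counts as 0 whatever h is. *)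
Lemma spread_entry_exp k : (k <= n)%N -> spread (entry_exp k) = (k * (n - k))%N.
Proof.
rewrite /entry_exp => kn; case: eqP => [->|_]; last by rewrite spreadU inordK.
rewrite /spread mul0n big1 // => l _; rewrite mulmnE mnm1E.
by case: eqP => [<-|_]; rewrite ?mul0n ?muln0.
Qed.

Lemma minor2_binomial (j1 j2 : 'I_n) : minor2 P j1 j2 =
  'X_[entry_exp j1 + entry_exp j2.+1] - 'X_[entry_exp j2 + entry_exp j1.+1].
Proof. by rewrite minor2E !matP_X -!mpolyXD. Qed.

Lemma normal_form u : exists v : 'X_{1..n.+1},
  [/\ (middle v <= 1)%N, wdeg g v = wdeg g u & ideal_minors2 P ('X_[u] - 'X_[v])].
Proof.
have [s] := ubnP (spread u); elim: s u => // s IH u us.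
have [u1|u2] := leqP (middle u) 1.
  by exists u; split=> //; rewrite subrr; apply: ideal_gen0.
have [i [j [w [/andP[i0 ij] jn uE]]]] := middle_gt1 u2.
have i1n : (i.-1 < n)%N by lia.
pose u' := (entry_exp i.-1 + (entry_exp j.+1 + w))%MM.
have eU (k : 'I_n.+1) : (0 < k)%N -> entry_exp k = U_(k)%MM.
  by rewrite /entry_exp lt0n => /negPf->; rewrite inord_val.
have j0 : (0 < j)%N by apply: leq_trans ij.
have deg_u' : wdeg g u' = wdeg g u.
  rewrite uE -(eU i i0) -(eU j j0) !wdegD !wdeg_entry_exp -1?ltnS //; last by lia.
  by apply/mnmP => l; rewrite !(mnmDE, mulmnE); nia.
have uu' : ideal_minors2 P ('X_[u] - 'X_[u']).
  have -> : 'X_[u] - 'X_[u'] = - 'X_[w] * minor2 P (Ordinal i1n) (Ordinal jn) :> R.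
    rewrite minor2_binomial /= prednK // (eU i i0) (eU j j0) mulNr mulrBr opprB -!mpolyXD.
    by rewrite uE /u'; congr ('X_[_] - 'X_[_]); apply/mnmP => l; rewrite !mnmDE; lia.
  apply/ideal_genM/ideal_gen_mem; exists (Ordinal i1n), (Ordinal jn); split=> //=.
  by lia.
have [|v [v1 vdeg vI]] := IH u'.
  move: us; rewrite ltnS; apply: leq_trans; rewrite uE -(eU i i0) -(eU j j0) !spreadD.
  rewrite !spread_entry_exp -1?ltnS //; last by lia.
  (* The spread drops by 2 (j - i + 1). The parameters p, e, k remove the truncated subtractions. *)
  have [p iE] : exists p, i = p.+1 :> nat by exists i.-1; lia.
  have [e jE] : exists e, j = (p + e).+1 :> nat by exists (j - i)%N; lia.
  have [k nE] : exists k, (n = (p + e + k).+2)%N by exists (n - j).-1; lia.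
  have -> : (n - i.-1 = (e + k).+2)%N by lia.
  have -> : (n - j.+1 = k)%N by lia.
  have -> : (n - i = (e + k).+1)%N by lia.
  have -> : (n - j = k.+1)%N by lia.
  by rewrite iE jE; lia.
exists v; split=> //; first by rewrite vdeg.
by rewrite -(subrK 'X_[u'] 'X_[u]) -addrA; apply: ideal_genD.
Qed.

Lemma independent_coef x y x' y' :
  (a *+ x + d *+ y)%MM = (a *+ x' + d *+ y')%MM -> x = x' /\ y = y'.
Proof.
move=> /mnmP E.
have /freeP/(_ (fun i => if i == 0 then x%:R - x'%:R else y%:R - y'%:R)) := free_ad.
rewrite big_ord_recl big_ord1 /= => /(_ _) F.
have {}F : forall i : 'I_2, (if i == 0 then x%:R - x'%:R else y%:R - y'%:R) = 0 :> rat.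
  apply: F; apply/rowP => l; rewrite !mxE.
  have /(congr1 (fun k : nat => k%:R : rat)) := E l.
  rewrite !mnmDE !mulmnE !natrD !natrM => El.
  transitivity ((a l)%:R * x%:R + (d l)%:R * y%:R -
    ((a l)%:R * x'%:R + (d l)%:R * y'%:R) : rat).
    by ring.
  by rewrite El subrr.
have /= F0 := F 0; have /= F1 := F 1.
by split; apply/eqP; rewrite -(Num.Theory.eqr_nat rat) -subr_eq0 ?F0 ?F1.
Qed.

(** The value e = 0 encodes the absence of a middle factor, so that for e < n it is always the
    residue modulo n of the coefficient of d in the degree. *)
Definition normal_monomial (e x y : nat) : 'X_{1..n.+1} :=
  ((if e == 0%N then 0 else U_(inord e)) + (U_(ord0) *+ x + U_(ord_max) *+ y))%MM.

Lemma middle_normal_monomial u : (middle u <= 1)%N ->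
  exists e x y, (e < n)%N /\ u = normal_monomial e x y.
Proof.
have nf0 w : middle w = 0%N -> w = normal_monomial 0 (w ord0) (w ord_max).
  move=> /eqP; rewrite sum_nat_eq0 => /forallP w0; apply/mnmP => k.
  rewrite !(mnmDE, mulmnE, mnm0E, mnm1E) add0n -!val_eqE /=.
  have [/eqP k0|k0] := eqVneq (k : nat) 0%N.
    have -> : k = ord0 by apply/eqP.
    by rewrite (_ : _ == _ = false) /= ?mul0n ?mul1n ?addn0 //; lia.
  have [kn|kn] := eqVneq (k : nat) n.
    by rewrite (_ : k = ord_max) ?mul0n ?mul1n //; apply: val_inj.
  have /eqP-> : w k == 0%N by apply: (implyP (w0 k)); have := leq_ord k; lia.
  by rewrite !mul0n.
rewrite leq_eqVlt ltnS leqn0 => /orP[/eqP u1|/eqP u0]; last first.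
  by exists 0%N, (u ord0), (u ord_max); split; [lia | apply: nf0].
have [|i [w [/andP[i0 im] uE]]] := @middle_gt0 u; first by rewrite u1.
exists i, (w ord0), (w ord_max); split=> //; rewrite uE {1}(nf0 w); last first.
  by move: u1; rewrite uE middleD middleU i0 im => -[].
by rewrite /normal_monomial add0m eqn0Ngt i0 inord_val.
Qed.

Lemma wdeg_normal_monomial e x y : (e < n)%N ->
  wdeg g (normal_monomial e x y) = (a *+ (x + h * y + h * (0 < e)) + d *+ (e + n * y))%MM.
Proof.
move=> en; rewrite /normal_monomial !wdegD !wdegMn !wdegU.
rewrite -(wdegU g ord_max) -(_ : entry_exp n = U_(ord_max)%MM); last first.
  rewrite /entry_exp ifF; last by lia.
  by congr (U_(_)%MM); apply: val_inj; rewrite /= inordK.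
rewrite wdeg_entry_exp //.
have -> : wdeg g (if e == 0%N then 0 else U_(inord e))%MM =
    (a *+ (h * (0 < e)) + d *+ e)%MM.
  have [->|e0] := posnP e.
    by rewrite muln0 !mulm0n addm0 -[0%MM](mulm0n 0) wdegMn mulm0n.
  rewrite muln1 -wdeg_entry_exp 1?ltnW // /entry_exp gtn_eqF //.
rewrite -[g ord0]/a; apply/mnmP => l; rewrite !(mnmDE, mulmnE); lia.
Qed.

(** By independence the degree determines the coefficients of a and d. Division of the latter, e + n
    y, by n recovers y and e, and the former then gives x. *)
Lemma normal_form_uniq u v : (middle u <= 1)%N -> (middle v <= 1)%N ->
  wdeg g u = wdeg g v -> u = v.
Proof.
move=> /middle_normal_monomial[e [x [y [en ->]]]].
move=> /middle_normal_monomial[e' [x' [y' [en' ->]]]].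
rewrite !wdeg_normal_monomial // => /independent_coef[xE].
rewrite addnC [(e' + _)%N]addnC ![(n * _)%N]mulnC => yE.
have yy' : y = y'.
  have := congr1 (divn^~ n) yE; rewrite /= !divnMDl ?(ltnW n_gt1) //.
  by rewrite !divn_small // !addn0.
have ee' : e = e' by move: yE; rewrite yy'; lia.
by congr normal_monomial => //; move: xE; rewrite yy' ee'; lia.
Qed.

Lemma defining_ideal_minors2 p : defining_ideal K g p <-> ideal_minors2 P p.
Proof.
split.
  apply: defining_ideal_binomials => u u' uu'.
  have [v [v1 vdeg vI]] := normal_form u; have [v' [v'1 v'deg v'I]] := normal_form u'.
  have vv' : v = v' by apply: normal_form_uniq; rewrite // vdeg v'deg.
  rewrite (_ : _ - _ = ('X_[u] - 'X_[v]) - ('X_[u'] - 'X_[v'])).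
    exact/ideal_genD/ideal_genN.
  by rewrite vv'; ring.
(* Conversely, both monomials of a minor have degree 2 h a + (j1 + j2 + 1) d. *)
move=> [l [b [s [Ss ->]]]]; rewrite /defining_ideal /phi rmorph_sum big1 // => i _.
rewrite rmorphM /= -/(phi g (s i)); have [j1 [j2 [_ ->]]] := Ss i.
rewrite minor2_binomial /phi raddfB /= -!/(phi g _) !phi_monomial !wdegD.
rewrite !wdeg_entry_exp //; try by rewrite ltnW.
rewrite (_ : (_ + _)%MM = (a *+ h + d *+ j2 + (a *+ h + d *+ j1.+1))%MM) ?subrr ?mulr0 //.
by apply/mnmP => k; rewrite !(mnmDE, mulmnE); lia.
Qed.

End PencilMatrix.

Theorem theorem5p9 (K : fieldType) (h n : nat) (a d : 'X_{1..2})
    (h_ge1 : (1 <= h)%N) (n_ge2 : (2 <= n)%N)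
    (free_ad : free [:: vecQ a; vecQ d])
    (min_gens : minimally_generating (gens a d h n)) :
  let g := gens a d h n in
  let I := defining_ideal K g in
  let P := matP K h n in
  let EN := eagon_northcott P (col_degree a d h n) (row_degree d) in
  (forall p : {mpoly K[n.+1]}, I p <-> ideal_minors2 P p) /\
  minimal_graded_resolution g I (C := truncate EN)
    (fun b => fc_diff EN 0 b tt).
Proof.
split; first by move=> p; apply: defining_ideal_minors2.
split=> [b u|k b b' u|p|v|k v|k b b'].
- exact: EN_augmentation_homogeneous.
- exact: EN_diff_homogeneous.
- by apply: iff_trans; [apply: defining_ideal_minors2|apply: ideal_minors2_augmentation].
- by apply: EN_augmentation_exact; [apply: acyclic_pencil01|apply: acyclic_pencil10].
- by apply: EN_exact; [apply: acyclic_pencil01|apply: acyclic_pencil10].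
- exact: EN_diff_minimal.
Qed.
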